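(* In the $k$-item $k$-bidder environment (any set of at most $k$ bidders may be allocated, and there are $k$ real bidders) with real bidder values drawn i.i.d. from the exponential distribution with mean $1$, the Deferred-Revelation Auction (DRA) over a public ledger, as described in the context, is not credible for any collateral $f<1$.
   Context: Bidders are quasi-linear with independent values; the exponential distribution with mean $1$ has CDF $1-e^{-t}$, virtual value $\varphi(v)=v-1$, monopoly reserve $1$. DRA over a public ledger (visible to all) with a perfectly hiding, perfectly binding, non-malleable commitment scheme: (1) every participant (real bidders and any fake bids fabricated by the auctioneer) commits to an identifier and a bid and deposits collateral $f$; the auctioneer declares a matroid feasibility constraint $\hat{\mathcal{F}}$ and distributions $\hat D_j$ (virtual values $\hat\varphi_j$) for all committed bids; (2) each committed bid is revealed or concealed, and collateral of concealed bids is burnt; (3) among revealed bids, the set $S\in\hat{\mathcal{F}}$ maximizing $\sum_{i\in S}\hat\varphi_i(b_i)$ (lexicographic tie-breaking) is allocated, each allocated bidder paying its critical bid (infimum bid at which it stays allocated). The auctioneer may fabricate bids, misreport distributions and constraint (keeping the allocated real bidders feasible in the true constraint), and choose which fake bids to conceal after seeing revealed real bids. Its revenue is real bidders' payments minus burnt collateral of its concealed fake bids. The DRA is credible for collateral $f$ if, when real bidders bid truthfully, the auctioneer maximizes expected revenue by fabricating no bids and reporting true distributions and constraint. *)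

(* Defs.v *)
From HB Require Import structures.
From mathcomp Require Import all_boot all_order all_algebra.
From mathcomp Require Import all_classical all_reals all_analysis.
Set Implicit Arguments.
Unset Strict Implicit.
Unset Printing Implicit Defensive.
Import Order.TTheory GRing.Theory Num.Theory.
Import numFieldNormedType.Exports.
Local Open Scope classical_set_scope.
Local Open Scope ring_scope.

Section DRA.
Variable R : realType.

Local Notation leb := (@lebesgue_measure R).

Definition is_density (d : R -> R) : Prop :=
  [/\ (forall x, 0 <= d x),
      leb.-integrable setT (EFin \o d)
    & \int[leb]_(x in setT) d x = 1].

Definition cdf_of (d : R -> R) (x : R) : R := \int[leb]_(t in `]-oo, x]) d t.

Definition virtual_value (d : R -> R) (v : R) : R := v - (1 - cdf_of d v) / d v.

Definition exp_density (t : R) : R := if 0 <= t then expR (- t) else 0.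

Definition is_matroid (n : nat) (I : {set {set 'I_n}}) : Prop :=
  [/\ (finset.set0 : {set 'I_n}) \in I,
      (forall A B : {set 'I_n}, B \in I -> A \subset B -> A \in I)
    & (forall A B : {set 'I_n}, A \in I -> B \in I -> (#|A| < #|B|)%N ->
          exists2 x, x \in B :\: A & x |: A \in I)].

Section Allocation.
Variables (n : nat) (F : {set {set 'I_n}}) (phi : 'I_n -> R -> R).

Definition vsum (b : 'I_n -> R) (S : {set 'I_n}) : R := \sum_(i in S) phi i (b i).

Definition feasible (rev : {set 'I_n}) (S : {set 'I_n}) : bool :=
  (S \in F) && (S \subset rev).

Definition maximiser (rev : {set 'I_n}) (b : 'I_n -> R) (S : {set 'I_n}) : bool :=
  feasible rev S && [forall T : {set 'I_n}, feasible rev T ==> (vsum b T <= vsum b S)].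

Definition lex_le (S T : {set 'I_n}) : bool :=
  (S == T) ||
  [exists i : 'I_n, [&& i \in S, i \notin T &
     [forall j : 'I_n, (j < i)%N ==> ((j \in S) == (j \in T))]]].

Definition allocation (rev : {set 'I_n}) (b : 'I_n -> R) : {set 'I_n} :=
  odflt (finset.set0 : {set 'I_n}) [pick S | maximiser rev b S &&
                       [forall T, maximiser rev b T ==> lex_le S T]].

Definition critical_bid (rev : {set 'I_n}) (b : 'I_n -> R) (i : 'I_n) : R :=
  inf [set x : R | i \in allocation rev (fun j => if j == i then x else b j)].

End Allocation.

(* Participants are identified by 'I_n (identifier order = index order  *)
(* used for lexicographic tie-breaking); the k real bidders occupy the  *)
(* positions real_pos (in their own order), the others are fake bids.   *)
Record strategy (k : nat) := Strategy {
  npart : nat;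
  real_pos : 'I_k -> 'I_npart;
  fake_bid : 'I_npart -> R;
  decl_constraint : {set {set 'I_npart}};
  decl_density : 'I_npart -> R -> R;
  conceal : ('I_k -> R) -> {set 'I_npart}        (* fake bids concealed, chosen after
                                                    seeing the revealed real bids *)
}.
Arguments npart {k} s.
Arguments real_pos {k} s _.
Arguments fake_bid {k} s _.
Arguments decl_constraint {k} s.
Arguments decl_density {k} s _ _.
Arguments conceal {k} s _.

Definition valid_strategy k (s : strategy k) : Prop :=
  [/\ (forall i j : 'I_k, (i < j)%N -> (real_pos s i < real_pos s j)%N),
      is_matroid (decl_constraint s)
    & (forall j, is_density (decl_density s j))].

Section Outcome.
Variables (k : nat) (f : R) (s : strategy k).

Definition is_real (j : 'I_(npart s)) : bool := [exists i, real_pos s i == j].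

Definition bids (v : 'I_k -> R) (j : 'I_(npart s)) : R :=
  if [pick i | real_pos s i == j] is Some i then v i else fake_bid s j.

(* truthful real bidders always reveal *)
Definition revealed (v : 'I_k -> R) : {set 'I_(npart s)} :=
  [set j | is_real j || (j \notin conceal s v)].

Definition concealed_fakes (v : 'I_k -> R) : {set 'I_(npart s)} :=
  [set j | ~~ is_real j & j \in conceal s v].

Definition phi_hat (j : 'I_(npart s)) := virtual_value (decl_density s j).

Definition auctioneer_revenue (v : 'I_k -> R) : R :=
  let A := allocation (decl_constraint s) phi_hat (revealed v) (bids v) in
  \sum_(i : 'I_k | real_pos s i \in A)
     critical_bid (decl_constraint s) phi_hat (revealed v) (bids v) (real_pos s i)
  - f * #|concealed_fakes v|%:R.

End Outcome.

Definition honest_strategy (k : nat) : strategy k :=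
  @Strategy k k id (fun _ => 0) (finset (fun S : {set 'I_k} => (#|S| <= k)%N))
    (fun _ => exp_density) (fun _ => finset.set0).

Definition vcons k (t : R) (w : 'I_k -> R) : 'I_k.+1 -> R :=
  fun i => if unlift ord0 i is Some j then w j else t.

Fixpoint has_expectation (k : nat) : (('I_k -> R) -> R) -> R -> Prop :=
  match k return (('I_k -> R) -> R) -> R -> Prop with
  | 0 => fun g r => g (fun _ => 0) = r
  | k'.+1 => fun g r =>
      exists h : R -> R,
        [/\ (forall t, 0 <= t -> has_expectation (fun w => g (vcons t w)) (h t)),
            leb.-integrable `[0, +oo[ (EFin \o (fun t => expR (- t) * h t))
          & \int[leb]_(t in `[0, +oo[) (expR (- t) * h t) = r]
  end.

Definition credible (k : nat) (f : R) : Prop :=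
  forall (s : strategy k) (r_s r_h : R),
    valid_strategy s ->
    has_expectation (auctioneer_revenue f s) r_s ->
    has_expectation (auctioneer_revenue f (honest_strategy k)) r_h ->
    r_s <= r_h.

End DRA.

(* Main.v *)
(* The auctioneer adds one fake bid [b = 2 - f > 1] and declares that it and the
   first real bidder exclude each other.  When that bidder's value [t] is at
   least [b], the fake bid stays revealed and raises the price from 1 to [b];
   when [1 <= t < b], the auctioneer conceals it, keeps the price 1 and burns
   [f].  The expected gain over the honest auction is
     expR (- b) * (b - 1) - f * (expR (-1) - expR (- b))
     = expR (-1) * (expR (f - 1) - f),
   which is positive because [1 + x < expR x] for [x != 0].  Revenues are sums of
   functions of one value each, so expectations reduce to one-dimensional
   integrals. *)
Require Import Defs.
From HB Require Import structures.
From mathcomp Require Import all_boot all_order all_algebra.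
From mathcomp Require Import all_classical all_reals all_analysis.
From mathcomp Require Import measurable_realfun ring lra.
Set Implicit Arguments.
Unset Strict Implicit.
Unset Printing Implicit Defensive.
Import Order.TTheory GRing.Theory Num.Theory.
Import numFieldNormedType.Exports.
Local Open Scope ring_scope.

(** * The exponential law and its virtual value *)

Section ExponentialLaw.
Variable R : realType.
Local Notation leb := (@lebesgue_measure R).

Lemma integral_expRN_itvcy (a : R) :
  (\int[leb]_(t in `[a, +oo[) (expR (- t))%:E = (expR (- a))%:E)%E.
Proof.
rewrite (@ge0_continuous_FTC2y _ _ (fun t => - expR (- t)) a 0).
- by rewrite -EFinB sub0r opprK.
- by move=> x _; exact: expR_ge0.
- apply: continuous_subspaceT => x.
  by apply: continuous_comp; [exact: opp_continuous|exact: continuous_expR].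
- by rewrite -oppr0; apply: cvgN; exact: cvgr_expR.
- by move=> x _; exact: ex_derive.
- apply: cvgN; apply: cvg_at_right_filter.
  by apply: continuous_comp; [exact: opp_continuous|exact: continuous_expR].
- move=> x _; rewrite derive1E derive_val.
  by rewrite /GRing.scale /= ?mulr1; ring.
Qed.

Lemma integrable_expRN_itvcy (a : R) :
  leb.-integrable `[a, +oo[ (fun t => (expR (- t))%:E).
Proof.
apply/integrableP; split.
  apply/measurable_EFinP; apply: measurable_funTS.
  by apply: measurableT_comp; [exact: measurable_expR|exact: measurable_funN].
under eq_integral do rewrite /= ger0_norm ?expR_ge0//.
by rewrite integral_expRN_itvcy ltry.
Qed.

Lemma exp_densityE : @exp_density R = (fun t => expR (- t)) \_ `[0, +oo[.
Proof.
apply/funext => t; rewrite patchE /exp_density mem_setE in_itv /= andbT.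
by case: ifP.
Qed.

Lemma is_density_exp : is_density (@exp_density R).
Proof.
split; rewrite ?exp_densityE.
- by move=> x; apply: restrict_ge0 => t _; exact: expR_ge0.
- rewrite -restrict_EFin; apply/integrable_restrict => //.
  by rewrite setTI; exact: integrable_expRN_itvcy.
- by rewrite -Rintegral_mkcond /Rintegral integral_expRN_itvcy oppr0 expR0.
Qed.

(** Splitting the total mass 1 at [x] leaves 1 minus the tail integral; [0 <= x] makes the density
    [expR (- t)] on the whole tail. *)
Lemma cdf_exp (x : R) : 0 <= x -> cdf_of (@exp_density R) x = 1 - expR (- x).
Proof.
move=> x0; have [_ int1 tot] := is_density_exp.
have split_R : [set: R]%classic = (`]-oo, x] `|` `]x, +oo[)%classic.
  apply/seteqP; split=> // t _ /=; rewrite !in_itv /= andbT.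
  by case: (leP t x) => ?; [left|right].
have := tot; rewrite split_R Rintegral_setU//=; first last.
- apply/disj_setPS => t /= []; rewrite !in_itv /= andbT => tx xt.
  by move: (le_lt_trans tx xt); rewrite ltxx.
- by rewrite -split_R.
rewrite /cdf_of => <-; rewrite [X in _ = _ + X - _](_ : _ = expR (- x)) ?addrK//.
rewrite /Rintegral -[RHS]/(fine (expR (- x))%:E) -integral_expRN_itvcy.
(* The complement of []-oo, x]] is an open ray; adding its endpoint does not change the integral. *)
rewrite -integral_itv_obnd_cbnd; last first.
  apply: measurable_funS (measurable_int _ (integrable_expRN_itvcy x)) => //.
  by apply: subset_itvr; rewrite bnd_simp.
congr fine; apply: eq_integral => t; rewrite inE /= in_itv /= andbT => xt.
by rewrite /exp_density ifT// (le_trans x0) ?ltW.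
Qed.

(* Below [0] the density vanishes, and the division by it gives [0]. *)
Lemma virtual_value_exp (x : R) :
  virtual_value (@exp_density R) x = if 0 <= x then x - 1 else x.
Proof.
rewrite /virtual_value /exp_density; case: ifPn => x0.
  by rewrite cdf_exp// subKr divff ?gt_eqF ?expR_gt0.
by rewrite invr0 mulr0 subr0.
Qed.

Lemma virtual_value_exp_ge0 (x : R) :
  (0 <= virtual_value (@exp_density R) x) = (1 <= x).
Proof. by rewrite virtual_value_exp; case: (leP 0 x) => x0; apply/idP/idP; lra. Qed.

(** The virtual value drops by 1 at 0, so it is not monotone on the whole line. With [1 <= b] its
    value at [b] is nonnegative, hence above all its values at negative points. *)
Lemma le_virtual_value_exp (b x : R) : 1 <= b ->
  (virtual_value (@exp_density R) b <= virtual_value (@exp_density R) x)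
  = (b <= x).
Proof.
by move=> b1; rewrite !virtual_value_exp; case: (leP 0 x); case: (leP 0 b) => ? ?;
  apply/idP/idP; lra.
Qed.

End ExponentialLaw.

(** * Expectations of sums of one-variable functions *)

Section Expectation.
Variable R : realType.
Local Notation leb := (@lebesgue_measure R).

(** Expectation under the exponential law, in the shape of a single layer of [has_expectation]. *)
Definition has_mean (p : R -> R) (m : R) : Prop :=
  leb.-integrable `[0, +oo[ (EFin \o (fun t => expR (- t) * p t)) /\
  \int[leb]_(t in `[0, +oo[) (expR (- t) * p t) = m.

Lemma has_meanD p q m n : has_mean p m -> has_mean q n ->
  has_mean (fun t => p t + q t) (m + n).
Proof.
move=> [ip <-] [iq <-]; rewrite /has_mean.
rewrite (_ : (fun t => expR (- t) * (p t + q t)) =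
             (fun t => expR (- t) * p t + expR (- t) * q t)); last first.
  by apply/funext => t; rewrite mulrDr.
by split; [apply: eq_integrable (integrableD _ ip iq)|rewrite RintegralD].
Qed.

Lemma has_meanZ c p m : has_mean p m -> has_mean (fun t => c * p t) (c * m).
Proof.
move=> [ip <-]; rewrite /has_mean.
rewrite (_ : (fun t => expR (- t) * (c * p t)) =
             (fun t => c * (expR (- t) * p t))); last first.
  by apply/funext => t; rewrite mulrCA.
by split; [apply: eq_integrable (integrableZl _ c ip)|rewrite RintegralZl].
Qed.

Lemma has_mean_ge (a : R) : 0 <= a ->
  has_mean (fun t => (a <= t)%R%:R) (expR (- a)).
Proof.
move=> a0; rewrite /has_mean.
have sub : (`[a, +oo[ `<=` `[0, +oo[)%classic.
  by apply: subset_itvr; rewrite bnd_simp.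
have -> : (fun t => expR (- t) * (a <= t)%R%:R) =
          (fun t => expR (- t)) \_ `[a, +oo[.
  apply/funext => t; rewrite patchE mem_setE in_itv /= andbT.
  by case: ifP => _; rewrite ?mulr1 ?mulr0.
split.
- rewrite -restrict_EFin; apply/integrable_restrict => //.
  by rewrite setIidr//; exact: integrable_expRN_itvcy.
- by rewrite -Rintegral_mkcondr setIidr// /Rintegral integral_expRN_itvcy.
Qed.

(** On the domain of integration the indicator of [0 <= t] is constantly 1, so this is a multiple of
    [has_mean_ge] at 0. *)
Lemma has_mean_cst (c : R) : has_mean (fun=> c) c.
Proof.
have [i m] := has_meanZ c (@has_mean_ge 0 (lexx _)).
rewrite oppr0 expR0 mulr1 in m; split.
- apply: eq_integrable i => // t; rewrite inE /= in_itv /= andbT => t0.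
  by rewrite t0 mulr1.
- rewrite -[RHS]m; apply: eq_Rintegral => t; rewrite inE /= in_itv /= andbT.
  by move=> t0; rewrite t0 mulr1.
Qed.

Lemma has_expectation_sum k (g : ('I_k -> R) -> R) (p : 'I_k -> R -> R)
    (m : 'I_k -> R) :
  (forall v, (forall i, 0 <= v i) -> g v = \sum_i p i (v i)) ->
  (forall i, has_mean (p i) (m i)) ->
  has_expectation g (\sum_i m i).
Proof.
(* The constant [c] collects the terms of the values already fixed by the outer integrals. *)
suff gen c : (forall v, (forall i, 0 <= v i) ->
      g v = c + \sum_i p i (v i)) ->
    (forall i, has_mean (p i) (m i)) -> has_expectation g (c + \sum_i m i).
  move=> gE pm; rewrite -[X in has_expectation _ X]add0r.
  by apply: gen => // v v0; rewrite add0r gE.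
elim: k => [|k IH] in g p m c *.
  by move=> gE _; rewrite /= gE ?big_ord0// => -[].
(* Integrating out the later values replaces their terms by their means; only the first value [t]
   remains free. *)
move=> gE pm; exists (fun t => (c + \sum_i m (lift ord0 i)) + p ord0 t);
have [i0 e0] := has_meanD (has_mean_cst (c + \sum_i m (lift ord0 i))) (pm ord0).
split=> //.
- move=> t t0; rewrite addrAC.
  apply: (IH _ (fun i => p (lift ord0 i))) => // w w0.
  rewrite gE; last by move=> i; rewrite /vcons; case: unliftP.
  rewrite big_ord_recl /vcons unlift_none addrA; congr (_ + _).
  by apply: eq_bigr => i _; rewrite liftK.
- by rewrite e0 big_ord_recl [_ + m ord0]addrC addrCA.
Qed.

End Expectation.

(** * The tie-breaking order is total *)

Section LexicographicOrder.
Variable n : nat.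
Implicit Types S T U : {set 'I_n}.

Variant lex_le_spec S T : Prop :=
  | LexEq of S = T
  | LexDiff i of i \in S & i \notin T &
      (forall j : 'I_n, (j < i)%N -> (j \in S) = (j \in T)).

Lemma lex_leP S T : reflect (lex_le_spec S T) (lex_le S T).
Proof.
apply: (iffP orP) => [[/eqP|/existsP[i /and3P[iS iT /forallP ST]]]|[->|i iS iT ST]].
- exact: LexEq.
- by apply: (LexDiff iS iT) => j ji; have /implyP/(_ ji)/eqP := ST j.
- by left.
- right; apply/existsP; exists i; rewrite iS iT /=.
  by apply/forallP => j; apply/implyP => /ST ->.
Qed.

Lemma lex_le_refl : reflexive (@lex_le n).
Proof. by move=> S; rewrite /lex_le eqxx. Qed.

Lemma lex_le_total : total (@lex_le n).
Proof.
move=> S T; have [->|/eqP neST] := eqVneq S T; first by rewrite lex_le_refl.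
have [i0 di0|eST] := pickP [pred i | (i \in S) != (i \in T)]; last first.
  by case: neST; apply/setP => i; have /negbFE/eqP := eST i.
(* The least index at which the two sets disagree decides their order. *)
case: (@arg_minnP _ i0 _ (@nat_of_ord n) di0) => i di min_i.
have STi (j : 'I_n) : (j < i)%N -> (j \in S) = (j \in T).
  by move=> ji; apply/eqP; apply: contraLR ji => /min_i; rewrite -leqNgt.
move: di => /=; case iS: (i \in S); case iT: (i \in T) => // _.
- by apply/orP; left; apply/lex_leP; apply: (LexDiff iS); rewrite ?iT.
- apply/orP; right; apply/lex_leP; apply: (LexDiff iT); rewrite ?iS//.
  by move=> j /STi.
Qed.

Lemma lex_le_trans : transitive (@lex_le n).
Proof.
move=> T S U /lex_leP[->//|i iS iT STi] /lex_leP[<-|j jT jU TUj].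
  by apply/lex_leP; exact: LexDiff STi.
apply/lex_leP; have [ij|ji|/val_inj ij] := ltngtP i j.
- apply: (LexDiff iS) => [|l li]; first by rewrite -TUj.
  by rewrite STi// TUj// (ltn_trans li).
- apply: (@LexDiff _ _ j) => // [|l lj]; first by rewrite STi.
  by rewrite STi ?TUj// (ltn_trans lj).
- by rewrite -ij (negbTE iT) in jT.
Qed.

End LexicographicOrder.

(** * Who wins: unconstrained bidders and competing pairs *)

Section Allocation.
Variables (R : realType) (n : nat) (F : {set {set 'I_n}}).
Variables (phi : 'I_n -> R -> R) (rev : {set 'I_n}) (b : 'I_n -> R).
Implicit Types S T : {set 'I_n}.
Hypothesis F0 : finset.set0 \in F.
Local Notation A := (allocation F phi rev b).
Local Notation w i := (phi i (b i)).

(** The empty set is feasible, so maximisers exist, and a total order on finitely many of them has a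
    least element. Hence [pick] succeeds and the default of [odflt] never occurs. *)
Lemma allocation_maximiser_lex_le :
  maximiser F phi rev b A /\ (forall T, maximiser F phi rev b T -> lex_le A T).
Proof.
have feas0 : feasible F rev finset.set0 by rewrite /feasible F0 finset.sub0set.
have [S0 maxS0] : exists S, maximiser F phi rev b S.
  case: (Order.TotalTheory.arg_maxP (vsum phi b) feas0) => S feasS maxS.
  exists S; rewrite /maximiser feasS; apply/forallP => T; apply/implyP.
  exact: maxS.
rewrite /allocation; case: pickP => [S /andP[mS /forallP lS]|noS].
  by split=> // T mT; have /implyP := lS T; exact.
have [S mS lS] :=
  extremumP id (@lex_le_refl n) (@lex_le_trans n) (@lex_le_total n) maxS0.
have /negP[] := noS S; rewrite mS; apply/forallP => T; apply/implyP.
exact: lS.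
Qed.

Lemma allocation_feasible : feasible F rev A.
Proof. by have [/andP[]] := allocation_maximiser_lex_le. Qed.

Lemma le_vsum_allocation T : feasible F rev T -> vsum phi b T <= vsum phi b A.
Proof.
move=> fT; have [/andP[_ /forallP/(_ T)/implyP maxA] _] :=
  allocation_maximiser_lex_le.
exact: maxA.
Qed.

Lemma allocation_lex_le T :
  feasible F rev T -> vsum phi b A <= vsum phi b T -> lex_le A T.
Proof.
move=> fT AT; have [_] := allocation_maximiser_lex_le; apply.
rewrite /maximiser fT; apply/forallP => S; apply/implyP => fS.
by rewrite (le_trans _ AT)// le_vsum_allocation.
Qed.

Lemma vsumU1 S i : i \notin S -> vsum phi b (i |: S) = w i + vsum phi b S.
Proof. by move=> iS; rewrite /vsum big_setU1. Qed.

Lemma vsumD1 S i : i \in S -> vsum phi b S = w i + vsum phi b (S :\ i).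
Proof. by move=> iS; rewrite /vsum (big_setD1 i). Qed.

Hypothesis F_sub : forall S T, T \in F -> S \subset T -> S \in F.

Lemma feasible_sub S T : S \subset T -> feasible F rev T -> feasible F rev S.
Proof.
move=> ST /andP[TF Trev]; rewrite /feasible (F_sub TF ST).
exact: fintype.subset_trans ST Trev.
Qed.

(** Dropping a winner of negative weight would raise the sum. *)
Lemma allocation_ge0 i : i \in A -> 0 <= w i.
Proof.
move=> iA; have := le_vsum_allocation (feasible_sub (subD1set _ i) allocation_feasible).
by rewrite (vsumD1 iA) lerDr.
Qed.

(** Adding [i] with nonnegative weight never lowers the sum, and at weight 0 the tie goes to the
    larger set, which comes first lexicographically. *)
Lemma allocation_free i : i \in rev ->
  (forall S, feasible F rev S -> i |: S \in F) ->
  (i \in A) = (0 <= w i).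
Proof.
move=> irev free; apply/idP/idP => [|wi0]; first exact: allocation_ge0.
apply/negPn/negP => iA; have fA := allocation_feasible.
have /allocation_lex_le : feasible F rev (i |: A).
  rewrite /feasible free//=; case/andP: fA => _ Arev.
  by rewrite finset.subUset finset.sub1set irev.
rewrite vsumU1// lerDr => /(_ wi0)/lex_leP[eA|j jA].
  by move: iA; rewrite {1}eA setU11.
by rewrite in_setU1 jA orbT.
Qed.

(* [a] and [z] exclude each other; [a] comes first and so wins ties. *)
Lemma allocation_contested (a z : 'I_n) : (a < z)%N ->
  a \in rev -> z \in rev -> 0 < w z ->
  (forall S, feasible F rev S -> z \notin S -> a |: S \in F) ->
  (forall S, feasible F rev S -> a \notin S -> z |: S \in F) ->
  (forall S, feasible F rev S -> ~~ ((a \in S) && (z \in S))) ->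
  (a \in A) = (w z <= w a).
Proof.
move=> az arev zrev wz0 addA addZ excl; have fA := allocation_feasible.
have Arev : A \subset rev by case/andP: fA.
have fD x : feasible F rev (A :\ x) by apply: feasible_sub fA; exact: subD1set.
have neaz : a != z by apply/eqP => eaz; rewrite eaz ltnn in az.
apply/idP/idP => [aA|waz].
  have zA : z \notin A by have := excl _ fA; rewrite aA.
  have zAa : z \notin A :\ a by rewrite in_setD1 (negbTE zA) andbF.
  (* Exchanging [a] for [z] in the winning set cannot raise the sum. *)
  have /le_vsum_allocation : feasible F rev (z |: (A :\ a)).
    rewrite /feasible addZ ?setD11//= finset.subUset finset.sub1set zrev /=.
    by apply: fintype.subset_trans Arev; exact: subD1set.
  by rewrite vsumU1// (vsumD1 aA) lerD2r.
apply/negPn/negP => aA; have [zA|zA] := boolP (z \in A).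
  have aAz : a \notin A :\ z by rewrite in_setD1 (negbTE aA) andbF.
  have /allocation_lex_le : feasible F rev (a |: (A :\ z)).
    rewrite /feasible addA ?setD11//= finset.subUset finset.sub1set arev /=.
    by apply: fintype.subset_trans Arev; exact: subD1set.
  rewrite vsumU1// (vsumD1 zA) lerD2r => /(_ waz)/lex_leP[eA|j jA jT lt_j].
    by move: aA; rewrite {1}eA setU11.
  (* Only [z] was removed from [A], so the first difference would be [z]; yet the sets already
     differ at the smaller index [a]. *)
  have jz : j = z.
    apply/eqP; move: jT; rewrite !inE jA andbT negb_or negbK.
    by case/andP.
  by move: aA; rewrite lt_j ?jz// setU11.
(* With neither competitor in [A], adding [a] strictly raises the sum, since its weight is at least
   that of [z], which is positive. *)
have /le_vsum_allocation : feasible F rev (a |: A).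
  by rewrite /feasible addA//= finset.subUset finset.sub1set arev.
by rewrite vsumU1// gerDr leNgt (lt_le_trans wz0).
Qed.

End Allocation.

(** For distinct [a] and [z] this is a partition matroid: capacity one on the pair, no limit
    elsewhere. If [a = z], that element is a loop. *)
Lemma is_matroid_exclusive_pair n (a z : 'I_n) :
  is_matroid [set S : {set 'I_n} | ~~ ((a \in S) && (z \in S))]%SET.
Proof.
split.
- by rewrite !inE.
- move=> S T; rewrite !inE => indT /fintype.subsetP ST.
  by apply: contra indT => /andP[/ST -> /ST ->].
- move=> S T; rewrite !inE => indS indT ltST.
  apply/exists_inP; apply: contraTT ltST; rewrite -leqNgt => /exists_inPn noX.
  (* Here [T] without [x] is contained in [S] without [y], which compares the cardinals. *)
  have swap_out (x y : 'I_n) : x \in T -> x \notin S -> y \in S -> y \notin T ->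
      (forall t, t \in T -> t \notin S -> (t == x) || (t == y)) ->
      (#|T| <= #|S|)%N.
    move=> xT xS yS yT only; rewrite (cardsD1 x T) (cardsD1 y S) xT yS.
    rewrite leq_add2l subset_leq_card//; apply/fintype.subsetP => t; rewrite !inE.
    move=> /andP[tx tT]; have ty : t != y by apply: contraNneq yT => <-.
    rewrite ty /=; apply: contraT => tS.
    by have := only _ tT tS; rewrite (negbTE tx) (negbTE ty).
  (* An element of [T] outside [S] that cannot be added to [S] belongs to the pair, and its partner
     is in [S]. *)
  have only t : t \in T -> t \notin S ->
      ((t == a) && (z \in S)) || ((t == z) && (a \in S)).
    move=> tT tS; have := noX t; rewrite !inE tT tS negbK => /(_ isT) /andP[].
    case/predU1P=> [a_t|aS] /predU1P[z_t|zS].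
    + by move: indT; rewrite a_t z_t tT.
    + by rewrite a_t eqxx zS.
    + by rewrite z_t eqxx aS orbT.
    + by move: indS; rewrite aS zS.
  have [TS|/fintype.subsetPn[x xT xS]] := boolP (T \subset S).
    exact: subset_leq_card.
  have only' t : t \in T -> t \notin S -> (t == a) || (t == z).
    by move=> tT tS; have /orP[] := only t tT tS => /andP[-> _]; rewrite ?orbT.
  have /orP[/andP[/eqP xa zS]|/andP[/eqP xz aS]] := only x xT xS; subst x.
  - by apply: (swap_out a z) => //; move: indT; rewrite xT.
  - apply: (swap_out z a) => //; first by move: indT; rewrite xT andbT.
    by move=> t tT tS; rewrite orbC only'.
Qed.

(** The winning bids form a closed ray, whose infimum is its endpoint. *)
Lemma critical_bid_threshold (R : realType) n (F : {set {set 'I_n}}) phi rev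
    (b : 'I_n -> R) (i : 'I_n) (c : R) :
  (forall x, (i \in allocation F phi rev (fun j => if j == i then x else b j))
             = (c <= x)) ->
  critical_bid F phi rev b i = c.
Proof.
move=> alloc; rewrite /critical_bid.
rewrite (_ : [set x | _]%classic = `[c, +oo[%classic) ?inf_itv//.
by apply/seteqP; split=> x /=; rewrite alloc in_itv /= andbT.
Qed.

(** * Real and fake participants of a strategy *)

Section Participants.
Variables (R : realType) (k : nat) (s : strategy R k).
Hypothesis real_inj : injective (real_pos s).

Lemma is_real_pos i : is_real (real_pos s i).
Proof. by apply/existsP; exists i. Qed.

Lemma bids_real v i : bids v (real_pos s i) = v i.
Proof.
rewrite /bids; case: pickP => [j /eqP/real_inj -> //|/(_ i)].
by rewrite eqxx.
Qed.

Lemma bids_fake v (j : 'I_(npart s)) : ~~ is_real j -> bids v j = @fake_bid R k s j.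
Proof.
rewrite /bids => fake_j; case: pickP => // i ij; case/negP: fake_j.
by apply/existsP; exists i.
Qed.

Lemma real_revealed v i : real_pos s i \in revealed s v.
Proof. by rewrite inE is_real_pos. Qed.

End Participants.

(** * Revenue of the honest auction *)

Section HonestStrategy.
Variables (R : realType) (k : nat) (f : R).
Local Notation s := (honest_strategy R k).

(** With as many items as bidders the constraint never binds, so each bidder separately faces the
    reserve price 1. *)
Lemma honest_revenue (v : 'I_k -> R) :
  auctioneer_revenue f s v = \sum_i (1 <= v i)%R%:R.
Proof.
have allocE (c : 'I_k -> R) (i : 'I_k) :
    (i \in allocation (decl_constraint s) (@phi_hat R k s) (revealed s v) c)
    = (1 <= c i).
  rewrite allocation_free -?virtual_value_exp_ge0//.
  - by rewrite inE cards0.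
  - by move=> S T; rewrite !inE => Tk /subset_leq_card /leq_trans; apply.
  - exact: (@real_revealed R k s).
  - by move=> S _; rewrite inE -[X in (_ <= X)%N]card_ord max_card.
have concealed0 : concealed_fakes s v = finset.set0.
  by apply/setP => j; rewrite !inE andbF.
rewrite /auctioneer_revenue concealed0 cards0 mulr0 subr0 big_mkcond.
apply: eq_bigr => i _; rewrite allocE.
rewrite (@critical_bid_threshold _ _ _ _ _ _ _ 1).
  by rewrite (@bids_real R k s)//; case: (1 <= v i).
by move=> x; rewrite allocE eqxx.
Qed.

End HonestStrategy.

(** * Revenue of the deviating auctioneer *)

Section ShillStrategy.
Variables (R : realType) (k : nat) (f : R).
Hypothesis f1 : f < 1.

(* [2 - f] maximises the expected gain
   [expR (- b) * (b - 1 + f) - f * expR (-1)] over the fake bids [b >= 1]. *)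
Definition shill_bid : R := 2 - f.

(* The fake participant [ord_max] competes with the first real bidder only; it
   comes last and so loses ties. *)
Definition shill_strategy : strategy R k.+1 :=
  @Strategy R k.+1 k.+2 (widen_ord (leqnSn k.+1)) (fun=> shill_bid)
    [set S : {set 'I_k.+2} | ~~ ((ord0 \in S) && (ord_max \in S))]%SET
    (fun=> @exp_density R)
    (fun v => if 1 <= v ord0 < shill_bid then [set ord_max]%SET
              else finset.set0).
Local Notation s := shill_strategy.
Local Notation F := (decl_constraint s).
Local Notation phi := (@phi_hat R k.+1 s).

Lemma shill_bid_gt1 : 1 < shill_bid.
Proof. by move: f1; rewrite /shill_bid; lra. Qed.

Lemma valid_shill : valid_strategy s.
Proof.
split=> //=; last by move=> _; exact: is_density_exp.
exact: is_matroid_exclusive_pair.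
Qed.

Lemma shill_real_inj : injective (real_pos s).
Proof. by move=> i j /(congr1 val) /= /val_inj. Qed.

Lemma ord_max_fake : ~~ @is_real R k.+1 s ord_max.
Proof.
apply/existsPn => i; apply/eqP => /(congr1 val) /= ik.
by have := ltn_ord i; rewrite ik ltnn.
Qed.

Lemma shill_concealed v :
  concealed_fakes s v = conceal s v.
Proof.
apply/setP => j; rewrite inE; case: (boolP (is_real j)) => // /=.
case: ifP => _; rewrite !inE//.
by case: eqVneq => // ->; rewrite (negbTE ord_max_fake).
Qed.

Lemma shill_revealed v :
  (ord_max \in revealed s v) = ~~ (1 <= v ord0 < shill_bid).
Proof.
rewrite inE (negbTE ord_max_fake) /=.
by case: ifP => _; rewrite !inE ?eqxx.
Qed.

Lemma shill_set0 : finset.set0 \in F.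
Proof. by rewrite !inE. Qed.

Lemma shill_sub (S T : {set 'I_(npart s)}) : T \in F -> S \subset T -> S \in F.
Proof.
have [_ sub _] := @is_matroid_exclusive_pair k.+2 ord0 ord_max.
exact: sub.
Qed.

(** The declared constraint involves only [ord0] and [ord_max], so every other real bidder is
    unconstrained. *)
Lemma shill_allocation_rest v c (i : 'I_k.+1) : i != ord0 ->
  (real_pos s i \in allocation F phi (revealed s v) c) =
  (1 <= c (real_pos s i)).
Proof.
move=> i0; rewrite allocation_free -?virtual_value_exp_ge0//.
- exact: shill_set0.
- exact: shill_sub.
- exact: real_revealed.
- move=> S /andP[]; rewrite !inE => indS _.
  have /negbTE -> : ord0 != real_pos s i by rewrite eq_sym.
  suff /negbTE -> : ord_max != real_pos s i by [].
  by apply: contraNneq ord_max_fake => ->; exact: is_real_pos.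
Qed.

Lemma shill_real_pos0 : real_pos s ord0 = ord0.
Proof. exact: val_inj. Qed.

(** The values [v] fix what is revealed while the bids [c] vary separately, as the critical bid
    requires. A concealed fake bid leaves [ord0] unconstrained; a revealed one competes with it. *)
Lemma shill_allocation_target v c : c ord_max = shill_bid ->
  (ord0 \in allocation F phi (revealed s v) c) =
  ((if 1 <= v ord0 < shill_bid then 1 else shill_bid) <= c ord0).
Proof.
move=> cz; have ord0_rev : ord0 \in revealed s v.
  by have := @real_revealed R _ s v ord0; rewrite shill_real_pos0.
have zrev := shill_revealed v; case: ifP zrev => _ /= zrev.
  rewrite allocation_free -?virtual_value_exp_ge0//.
  - exact: shill_set0.
  - exact: shill_sub.
  - move=> S /andP[_ /fintype.subsetP Srev]; rewrite !inE /=.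
    by apply: contraFN zrev => /Srev.
rewrite (@allocation_contested _ _ _ _ _ _ shill_set0 shill_sub ord0 ord_max) ?cz//.
- by rewrite -[RHS](le_virtual_value_exp _ (ltW shill_bid_gt1)).
- rewrite /phi_hat /= virtual_value_exp; have := shill_bid_gt1.
  by case: ifP => _; lra.
- by move=> S _ zS; rewrite !inE.
- by move=> S _ aS; rewrite !inE (negbTE aS).
- by move=> S /andP[]; rewrite inE.
Qed.

(** For the first bidder the formula gives [1 - f], the price 1 less the burnt collateral, when
    [1 <= t < shill_bid]; above, it gives [2 - f], which is [shill_bid] itself. *)
Definition shill_payoff (i : 'I_k.+1) (t : R) : R :=
  if i == ord0 then (1 - f) * (1 <= t)%R%:R + (shill_bid <= t)%R%:R
  else (1 <= t)%R%:R.

Lemma shill_revenue (v : 'I_k.+1 -> R) :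
  auctioneer_revenue f s v = \sum_i shill_payoff i (v i).
Proof.
(* Concealment depends on the first value only, so the burnt collateral is charged to the first
   bidder's term. *)
rewrite /auctioneer_revenue big_mkcond !big_ord_recl addrAC; congr (_ + _).
  have bz x : (fun j => if j == ord0 then x else @bids R k.+1 s v j) ord_max
      = shill_bid.
    by rewrite /= bids_fake// ord_max_fake.
  have b0 : @bids R k.+1 s v ord0 = v ord0.
    by have := bids_real shill_real_inj v ord0; rewrite shill_real_pos0.
  (* The revealed set stays that of the true [v] while the bid [x] varies, so the threshold does not
     depend on [x]. *)
  have crit : critical_bid F phi (revealed s v) (@bids R k.+1 s v) ord0 =
      if 1 <= v ord0 < shill_bid then 1 else shill_bid.
    apply: critical_bid_threshold => x.
    by rewrite shill_allocation_target ?bz// eqxx.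
  rewrite shill_real_pos0 crit shill_allocation_target; last first.
    by rewrite bids_fake// ord_max_fake.
  rewrite shill_concealed b0 /shill_payoff eqxx /=.
  have := shill_bid_gt1; rewrite /shill_bid.
  case: (leP 1 (v ord0)) => v1 /=; case: (ltP (v ord0) (2 - f)) => vb /=;
    rewrite ?cards1 ?cards0 ?v1 ?vb => b1; lra.
apply: eq_bigr => i _; rewrite shill_allocation_rest//.
rewrite (bids_real shill_real_inj) /shill_payoff /=.
rewrite (@critical_bid_threshold _ _ _ _ _ _ _ 1); first by case: (1 <= _).
by move=> x; rewrite shill_allocation_rest// eqxx.
Qed.

End ShillStrategy.

(** * Comparison of the expected revenues *)

Theorem mainTheorem5 (R : realType) (k : nat) (f : R) :
  (0 < k)%N -> f < 1 -> ~ credible k f.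
Proof.
case: k => // k _ f1 cred.
have Eh : has_expectation (auctioneer_revenue f (honest_strategy R k.+1))
    (\sum_(i < k.+1) expR (- 1)).
  apply: (has_expectation_sum (p := fun _ t => (1 <= t)%R%:R)) => [v _|i].
    exact: honest_revenue.
  exact: has_mean_ge.
have Es : has_expectation (auctioneer_revenue f (shill_strategy k f))
    (\sum_(i < k.+1) if i == ord0
       then (1 - f) * expR (- 1) + expR (- shill_bid f) else expR (- 1)).
  apply: (has_expectation_sum (p := shill_payoff f)) => [v _|i].
    exact: shill_revenue.
  rewrite /shill_payoff; case: ifP => _; last exact: has_mean_ge.
  apply: has_meanD; first exact: has_meanZ (has_mean_ge ler01).
  by apply: has_mean_ge; rewrite (le_trans ler01)// ltW// shill_bid_gt1.
have := cred _ _ _ (valid_shill k f) Es Eh.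
rewrite !big_ord_recl /= lerD2r leNgt => /negP[].
(* After the common factor [expR (- 1)] is taken out, the claim is [f < expR (f - 1)]. *)
have -> : expR (- shill_bid f) = expR (- 1) * expR (f - 1) :> R.
  by rewrite -expRD /shill_bid; congr expR; ring.
have : 1 + (f - 1) < expR (f - 1) by apply: expR_gt1Dx; rewrite subr_eq0 lt_eqF.
have := @expR_gt0 R (- 1); nra.
Qed.
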